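(* Let $k$ be an algebraically closed field of characteristic $0$ and let $M=(X,Y)$ be a finite dimensional indecomposable module over $R=k\langle x,y\mid xy-yx=y^2\rangle$, where $X$ and $Y$ denote the linear operators on $M$ by which $x$ and $y$ act. Then $X$ has a unique eigenvalue. *)

(* Defs.v *)
From HB Require Import structures.
From mathcomp Require Import all_boot all_order all_algebra.
From mathcomp Require Import finmap generic_quotient ring_quotient.
From mathcomp.classical Require Import boolp.
From mathcomp.multinomials Require Import monalg.

Set Implicit Arguments.
Unset Strict Implicit.
Unset Printing Implicit Defensive.

Import GRing.Theory Quotient.

Local Open Scope ring_scope.
Local Open Scope quotient_scope.

(* {fmonom bool} is the free monoid on two letters, so this is the free
   associative algebra k<x, y>, with x the letter true and y the letter
   false. *)
Notation free_alg2 k := {malg k[{fmonom bool}]}.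

Section JordanPlane.
Variable k : fieldType.

Definition free_x : free_alg2 k := << fmu true >>.
Definition free_y : free_alg2 k := << fmu false >>.

Definition jordan_rel : free_alg2 k :=
  free_x * free_y - free_y * free_x - free_y ^+ 2.

(* The two-sided ideal generated by jordan_rel. *)
Definition jordan_ideal : {pred free_alg2 k} := fun f =>
  `[< exists s : seq (free_alg2 k * free_alg2 k),
        f = \sum_(p <- s) p.1 * jordan_rel * p.2 >].

Lemma jordan_ideal_zmod_closed : zmod_closed jordan_ideal.
Proof.
split; first by apply/asboolP; exists [::]; rewrite big_nil.
move=> _ _ /asboolP[s ->] /asboolP[t ->]; apply/asboolP.
exists (s ++ [seq (- p.1, p.2) | p <- t]).
rewrite big_cat big_map /= -sumrN; congr (_ + _).
by apply: eq_bigr => p _; rewrite !mulNr.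
Qed.

HB.instance Definition _ := GRing.isZmodClosed.Build (free_alg2 k)
  jordan_ideal jordan_ideal_zmod_closed.

Lemma jordan_idealMl f g : g \in jordan_ideal -> f * g \in jordan_ideal.
Proof.
move=> /asboolP[s ->]; apply/asboolP; exists [seq (f * p.1, p.2) | p <- s].
by rewrite big_map mulr_sumr; apply: eq_bigr => p _; rewrite !mulrA.
Qed.

Lemma jordan_idealMr f g : f \in jordan_ideal -> f * g \in jordan_ideal.
Proof.
move=> /asboolP[s ->]; apply/asboolP; exists [seq (p.1, p.2 * g) | p <- s].
by rewrite big_map mulr_suml; apply: eq_bigr => p _; rewrite !mulrA.
Qed.

Lemma jordan_rel_in_ideal : jordan_rel \in jordan_ideal.
Proof.
by apply/asboolP; exists [:: (1, 1)]; rewrite big_seq1 mul1r mulr1.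
Qed.

Lemma jordan_ideal1 : 1 \notin jordan_ideal.
Proof.
have z b : mcoeff (mone : {fmonom bool}) (<< fmu b >> : free_alg2 k) = 0.
  by rewrite mcoeffU1 fmP fmU fm1.
apply/negP => /asboolP[s e].
have := congr1 (mcoeff (mone : {fmonom bool})) e => /eqP.
rewrite rmorph1 raddf_sum big1 ?oner_eq0 // => p _ /=.
rewrite !rmorphM /jordan_rel !rmorphB /= !rmorphM /= !z.
by rewrite !mulr0 !subr0 mulr0 mul0r.
Qed.

Lemma free_scalerAr (a : k) (f g : free_alg2 k) : a *: (f * g) = f * (a *: g).
Proof.
apply/malgP => m; rewrite mcoeffZ mcoeffMl mulr_sumr.
rewrite (mcoeffMlw m (fsubset_refl (msupp f)) (msuppZ_le a g)).
apply: eq_bigr => k1 _; rewrite mulr_sumr; apply: eq_bigr => k2 _.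
by rewrite mcoeffZ mulrCA mulrnAr.
Qed.

Definition jordan_plane := {quot jordan_ideal}.

HB.instance Definition _ := GRing.Zmodule.on jordan_plane.

Definition jordan_pi (f : free_alg2 k) : jordan_plane :=
  \pi_({quot jordan_ideal}) f.

Definition jordan_repr (u : jordan_plane) : free_alg2 k :=
  repr (u : {quot jordan_ideal}).

Lemma jordan_reprK u : jordan_pi (jordan_repr u) = u.
Proof. exact: reprK. Qed.

Lemma jordan_piP f g : jordan_pi f = jordan_pi g <-> f - g \in jordan_ideal.
Proof.
by rewrite (idealrBE jordan_ideal); split=> [e|/eqP//]; apply/eqP.
Qed.

Lemma jordan_piD f g : jordan_pi (f + g) = jordan_pi f + jordan_pi g.
Proof. exact: (@pi_add _ jordan_ideal). Qed.

Definition jordan_one := jordan_pi 1.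
Definition jordan_mul u v := jordan_pi (jordan_repr u * jordan_repr v).
Definition jordan_scale (a : k) u := jordan_pi (a *: jordan_repr u).

Lemma jordan_piM f g :
  jordan_pi (f * g) = jordan_mul (jordan_pi f) (jordan_pi g).
Proof.
apply/jordan_piP; set f' := jordan_repr _; set g' := jordan_repr _.
have -> : f * g - f' * g' = (f - f') * g + f' * (g - g').
  by rewrite mulrBl mulrBr addrA subrK.
by apply: rpredD; [apply: jordan_idealMr|apply: jordan_idealMl];
  apply/jordan_piP; rewrite jordan_reprK.
Qed.

Lemma jordan_piZ a f : jordan_pi (a *: f) = jordan_scale a (jordan_pi f).
Proof.
apply/jordan_piP; rewrite -scalerBr -mul_malgC; apply: jordan_idealMl.
by apply/jordan_piP; rewrite jordan_reprK.
Qed.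

Let piE := (jordan_piD, jordan_piM, jordan_piZ).

Lemma jordan_mulA : associative jordan_mul.
Proof.
move=> u v w; rewrite -[u]jordan_reprK -[v]jordan_reprK -[w]jordan_reprK.
by rewrite -!piE mulrA.
Qed.

Lemma jordan_mul1 : left_id jordan_one jordan_mul.
Proof. by move=> u; rewrite -[u]jordan_reprK -!piE mul1r. Qed.

Lemma jordan_mulr1 : right_id jordan_one jordan_mul.
Proof. by move=> u; rewrite -[u]jordan_reprK -!piE mulr1. Qed.

Lemma jordan_mulDl : left_distributive jordan_mul +%R.
Proof.
move=> u v w; rewrite -[u]jordan_reprK -[v]jordan_reprK -[w]jordan_reprK.
by rewrite -!piE mulrDl.
Qed.

Lemma jordan_mulDr : right_distributive jordan_mul +%R.
Proof.
move=> u v w; rewrite -[u]jordan_reprK -[v]jordan_reprK -[w]jordan_reprK.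
by rewrite -!piE mulrDr.
Qed.

Lemma jordan_one_neq0 : jordan_one != 0.
Proof.
have pi0 : jordan_pi 0 = 0.
  by apply: (addrI (jordan_pi 0)); rewrite -piE !addr0.
rewrite -pi0; apply/eqP => /jordan_piP.
by rewrite subr0 (negPf jordan_ideal1).
Qed.

HB.instance Definition _ := GRing.Zmodule_isNzRing.Build jordan_plane
  jordan_mulA jordan_mul1 jordan_mulr1 jordan_mulDl jordan_mulDr
  jordan_one_neq0.

Lemma jordan_scaleA a b u :
  jordan_scale a (jordan_scale b u) = jordan_scale (a * b) u.
Proof. by rewrite -[u]jordan_reprK -!piE scalerA. Qed.

Lemma jordan_scale1 : left_id 1 jordan_scale.
Proof. by move=> u; rewrite -[u]jordan_reprK -!piE scale1r. Qed.

Lemma jordan_scaleDr : right_distributive jordan_scale +%R.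
Proof.
move=> a u v; rewrite -[u]jordan_reprK -[v]jordan_reprK.
by rewrite -!piE scalerDr.
Qed.

Lemma jordan_scaleDl u : {morph jordan_scale^~ u : a b / a + b}.
Proof. by move=> a b; rewrite -[u]jordan_reprK -!piE scalerDl. Qed.

HB.instance Definition _ := GRing.Zmodule_isLmodule.Build k jordan_plane
  jordan_scaleA jordan_scale1 jordan_scaleDr jordan_scaleDl.

Lemma jordan_scaleAl (a : k) (u v : jordan_plane) : a *: (u * v) = (a *: u) * v.
Proof.
rewrite /GRing.scale /GRing.mul /= -[u]jordan_reprK -[v]jordan_reprK.
by rewrite -!piE scalerAl.
Qed.

HB.instance Definition _ :=
  GRing.Lmodule_isLalgebra.Build k jordan_plane jordan_scaleAl.

Lemma jordan_scaleAr (a : k) (u v : jordan_plane) : a *: (u * v) = u * (a *: v).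
Proof.
rewrite /GRing.scale /GRing.mul /= -[u]jordan_reprK -[v]jordan_reprK.
by rewrite -!piE free_scalerAr.
Qed.

HB.instance Definition _ :=
  GRing.Lalgebra_isAlgebra.Build k jordan_plane jordan_scaleAr.

Lemma jordan_pi_is_linear : linear jordan_pi.
Proof. by move=> a f g; rewrite !piE. Qed.

HB.instance Definition _ := GRing.isLinear.Build k (free_alg2 k) jordan_plane
  *:%R jordan_pi jordan_pi_is_linear.

Lemma jordan_pi_is_monoid_morphism : monoid_morphism jordan_pi.
Proof. by split=> // f g; rewrite piE. Qed.

HB.instance Definition _ := GRing.isMonoidMorphism.Build (free_alg2 k)
  jordan_plane jordan_pi jordan_pi_is_monoid_morphism.

Definition jordan_x : jordan_plane := jordan_pi free_x.
Definition jordan_y : jordan_plane := jordan_pi free_y.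

Lemma jordan_xy : jordan_x * jordan_y - jordan_y * jordan_x = jordan_y ^+ 2.
Proof.
rewrite -rmorphXn -!rmorphM -rmorphB; apply/jordan_piP.
exact: jordan_rel_in_ideal.
Qed.

End JordanPlane.

Arguments jordan_x {k}.
Arguments jordan_y {k}.

Section FiniteDimensionalModules.
Variables (k : fieldType) (A : algType k).

(* A finite dimensional left A-module: a finite dimensional k-vector space V
   with a morphism of k-algebras from A to End(V). *)
Record fdModule := FdModule {
  fdm_space :> vectType k;
  fdm_act : A -> 'End(fdm_space);
  fdm_act_linear : linear fdm_act;
  fdm_act1 : fdm_act 1 = \1%VF;
  fdm_actM : forall a b, fdm_act (a * b) = (fdm_act a \o fdm_act b)%VF
}.

Definition submodule (M : fdModule) (U : {vspace M}) : Prop :=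
  forall a : A, (fdm_act M a @: U <= U)%VS.

Definition indecomposable (M : fdModule) : Prop :=
  (fullv : {vspace M}) != 0%VS /\
  forall U W : {vspace M}, submodule U -> submodule W ->
    (U + W)%VS = fullv -> (U :&: W)%VS = 0%VS -> U = 0%VS \/ W = 0%VS.

End FiniteDimensionalModules.

(* Main.v *)
Require Import Defs.
From mathcomp Require Import all_boot all_algebra.
From mathcomp Require Import finmap.
From mathcomp.classical Require Import boolp.
From mathcomp.multinomials Require Import monalg.

Set Implicit Arguments.
Unset Strict Implicit.
Unset Printing Implicit Defensive.

Local Open Scope ring_scope.
Import GRing.Theory.

(** Why [X] has only one eigenvalue.  From [xy - yx = y^2] one gets
    [[x, p(y)] = p'(y) y^2] for every polynomial [p].  Hence any relation
    [y^d q(y) = 0] yields [y^(d+2) q'(y) = 0]; differentiating until [q] is a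
    nonzero constant, which characteristic 0 permits, shows that [Y] is
    nilpotent ([algebraic_nilpotent]).

    Let [a] be an eigenvalue of [X] and [z := a - X], up to the order of the
    products an operator that satisfies the same relation with [Y].
    Fitting's lemma splits [M] as [ker z^d (+) im z^d] for large [d].  Moving
    a power of [Y] across a power of [z] either costs no [z] or trades one [z]
    for one more [Y], and only boundedly many trades are possible as [Y] is
    nilpotent ([mul_nilp_expr], [expr_nilp_mul]); hence [Y] preserves both
    summands.  The argument is carried out with the idempotent [e] that
    projects onto [im z^d], which therefore commutes with [X] and [Y]
    ([fitting_idempotent_comm]).

    On a [b]-eigenvector of [X], [e] is the identity if [b <> a] and zero if
    [b = a] ([spectral_projector]).  On an indecomposable module [e] can only
    be [0] or the identity; it kills an [a]-eigenvector, so it is [0], and no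
    [b <> a] is an eigenvalue. *)

(** * Algebraic elements with a quadratic commutator *)

(** Each step that brings one [z] to the right of [y^m] leaves, besides
    [y^m z], a multiple of [y^(m+1)]: it consumes a [z] without delivering one
    on the right.  This can happen at most [s] times before the power of [y]
    vanishes, so [n] of the [n + s] factors reach the right end.  The integer
    [c] is there so that the mirror statement is the instance [- c] in the
    converse ring. *)
Lemma mul_nilp_expr (R : nzRingType) (c : int) (z y : R) (d : nat) :
    z * y = y * z + y ^+ 2 *~ c -> y ^+ d = 0 ->
  forall s n m, (d <= m + s)%N ->
    exists w, z ^+ (n + s) * y ^+ m = w * z ^+ n.
Proof.
move=> zy yd0.
have zyX m : z * y ^+ m = y ^+ m * z + y ^+ m.+1 *~ (c * m%:Z).
  elim: m => [|m IHm]; first by rewrite expr0 mulr1 mul1r mulr0 mulr0z addr0.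
  rewrite exprSr mulrA IHm mulrDl -mulrA zy mulrDr mulrA -exprSr -addrA.
  congr (_ + _); rewrite mulrzAr mulrzAl -exprD -exprSr addnC -mulrzDr.
  by rewrite intS mulrDr mulr1.
elim=> [|s IHs] n m le_d.
  exists 0; rewrite mul0r; move: le_d; rewrite addn0 => /subnK <-.
  by rewrite [y ^+ _]exprD yd0 !mulr0.
elim: n => [|n [w IHn]].
  by exists (z ^+ (0 + s.+1) * y ^+ m); rewrite mulr1.
have [w' IHs'] := IHs n.+1 m.+1 (leq_trans le_d (eq_leq (addnS _ _))).
exists (w + w' *~ (c * m%:Z)); rewrite addSn exprSr -mulrA zyX mulrDr mulrA.
rewrite IHn addnS -addSn mulrzAr IHs' mulrDl mulrzAl -[w * _ * _]mulrA.
by rewrite -exprSr.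
Qed.

(** The mirror image of [mul_nilp_expr]: passing to the converse ring swaps the
    two sides and negates the commutator. *)
Lemma expr_nilp_mul (R : nzRingType) (c : int) (z y : R) (d : nat) :
    z * y = y * z + y ^+ 2 *~ c -> y ^+ d = 0 ->
  forall s n m, (d <= m + s)%N ->
    exists w, y ^+ m * z ^+ (n + s) = z ^+ n * w.
Proof.
move=> zy yd0 s n m le_d.
have zyc : (z : R^c) * y = (y : R^c) * z + (y : R^c) ^+ 2 *~ (- c).
  rewrite revrX mulrNz; have := addrK (y ^+ 2 *~ c) (y * z).
  by rewrite -zy => yzE; exact: esym yzE.
have yd0c : (y : R^c) ^+ d = 0 by rewrite revrX.
have [w] := mul_nilp_expr zyc yd0c n le_d.
by rewrite !revrX; exists w.
Qed.

Section Algebraic.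
Variables (k : fieldType) (A : algType k).
Implicit Types (x y z : A) (p q : {poly k}).

Definition algebraic z := exists2 p : {poly k}, p != 0 & horner_alg z p = 0.

(** The derivation [[x, _]] sends [y] to [y^2], so it acts on polynomials in
    [y] as [y^2 d/dy]. *)
Lemma commutator_horner_alg x y p : x * y - y * x = y ^+ 2 ->
  x * horner_alg y p - horner_alg y p * x = horner_alg y p^`() * y ^+ 2.
Proof.
move=> xy; elim/poly_ind: p => [|p c IHp].
  by rewrite deriv0 raddf0 mulr0 !mul0r subrr.
rewrite derivD derivC addr0 derivM derivX mulr1 !rmorphD !rmorphM /=.
rewrite horner_algX horner_algC mulrDr mulrDl opprD addrACA.
rewrite -scalerAr -scalerAl mulr1 mul1r subrr addr0.
set P := horner_alg y p in IHp *; set P' := horner_alg y _ in IHp *.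
have -> : x * (P * y) - P * y * x = (x * P - P * x) * y + P * (x * y - y * x).
  by rewrite mulrBl mulrBr !mulrA addrA subrK.
by rewrite IHp xy mulrDl expr2 !mulrA.
Qed.

(** Taking the commutator of [x] with [y^d q(y) = 0] gives
    [y^(d+2) q'(y) = 0], the other term [d y^(d+1) q(y)] being already zero.
    The degree of [q] thus drops until [q] is a nonzero constant. *)
Lemma algebraic_nilpotent x y : [pchar k] =i pred0 ->
  x * y - y * x = y ^+ 2 -> algebraic y -> exists d, y ^+ d = 0.
Proof.
move=> /pcharf0P char0 xy [p p0 py0].
have [n le_pn] := ubnP (size p).
have {py0} : horner_alg y ('X^0 * p) = 0 by rewrite mul1r.
elim: n p 0%N le_pn p0 => // n IHn p d; rewrite ltnS => le_pn p0 py0.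
have [p1|p1] := leqP (size p) 1.
  move: p0 py0; rewrite (size1_polyC p1) polyC_eq0 => c0.
  rewrite rmorphM rmorphXn /= horner_algX horner_algC -scalerAr mulr1.
  by move=> /eqP; rewrite scaler_eq0 (negPf c0) => /eqP; exists d.
have p'0 : p^`() != 0.
  apply/eqP => p'_eq0; move: (lead_coef_eq0 p) p1.
  rewrite (negPf p0) /lead_coef; case: (size p) => [|[|m]] //= pm_neq0 _.
  have /eqP := coef_deriv p m.
  by rewrite p'_eq0 coef0 eq_sym -mulr_natr mulf_eq0 char0 pm_neq0.
apply: (IHn p^`() d.+2) => //; first exact: leq_trans (lt_size_deriv p0) _.
have dE : ('X^d * p)^`() * 'X^2 = 'X^d * p * 'X *+ d + 'X^(d.+2) * p^`().
  rewrite derivM derivXn mulrDl -[in RHS](addn2 d) exprD.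
  congr (_ + _); last by rewrite mulrAC.
  (* For d = 0 the truncated exponent d - 1 is harmless: the term is 0. *)
  case: d {py0} => [|d]; first by rewrite !mulr0n !mul0r.
  by rewrite !mulrnAl /= ['X^(d.+1)]exprSr expr2 !mulrA ['X^d * p * 'X]mulrAC.
have := commutator_horner_alg ('X^d * p) xy.
rewrite py0 mulr0 mul0r subrr -{2}[y]horner_algX -rmorphXn -rmorphM /= dE.
by rewrite rmorphD rmorphMn rmorphM /= py0 mul0r mul0rn add0r.
Qed.

(** Write an annihilating polynomial of [z] as ['X^d * q] with [q(0) != 0].
    The polynomials ['X^n] and [q] are coprime, and a Bezout relation
    [u 'X^n + v q = 1] evaluated at [z] and multiplied by [z^d] leaves
    [z^d u(z) z^n = z^d].  The exponent [d] does not depend on [n], so that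
    [n] may be chosen as large as [fitting_idempotent_comm] requires. *)
Lemma algebraic_fitting z : algebraic z ->
  exists d, forall n, exists u,
    GRing.comm u z /\ z ^+ d * (u * z ^+ n) = z ^+ d.
Proof.
move=> [p p0 pz0]; have [d [q q0 pE]] := multiplicity_XsubC p 0.
exists d => n; move: q0; rewrite p0 /= => q0.
rewrite polyC0 subr0 in pE.
have /Bezout_eq1_coprimepP[[u v] /= uv1] : coprimep ('X^n) q.
  by apply: coprimep_expl; rewrite coprimep_sym coprimepX.
have horX m : horner_alg z 'X^m = z ^+ m by rewrite rmorphXn /= horner_algX.
exists (horner_alg z u); split.
  by rewrite /GRing.comm -{2 3}[z]horner_algX -!rmorphM mulrC.
rewrite -!horX -!rmorphM /= (canRL (addrK _) uv1) mulrBr mulr1 rmorphB /=.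
rewrite mulrCA ['X^d * q]mulrC -pE rmorphM /= pz0 mulr0.
by rewrite subr0.
Qed.

(** With [e = u z^(d+s+1)], where [z^d (1 - e) = 0] and [y^(s+1) = 0], the
    element [e y] is a left multiple of [z^d], whence [e y (1 - e) = 0], and
    [y e] is a right multiple of [z^d], whence [(1 - e) y e = 0].  Both [e y]
    and [y e] are therefore equal to [e y e]. *)
Lemma fitting_idempotent_comm z y :
    z * y - y * z = y ^+ 2 -> algebraic z -> (exists s, y ^+ s = 0) ->
  exists d e u, [/\ e * e = e, GRing.comm e z, GRing.comm e y,
     z ^+ d * e = z ^+ d & e = z * u].
Proof.
move=> zy zalg [s ys0]; have [d fit] := algebraic_fitting zalg.
have {}zy : z * y = y * z + y ^+ 2 *~ 1 by rewrite mulr1z -zy addrC subrK.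
have ys1 : y ^+ s.+1 = 0 by rewrite exprS ys0 mulr0.
have [u [uz zde]] := fit (d + s.+1)%N; set e := u * _ in zde.
have ez : GRing.comm e z.
  by apply: commr_sym; apply: commrM; [apply: commr_sym | apply: commrX].
have [w] := mul_nilp_expr zy ys1 d (m := 1) (leqW (leqnn s.+1)).
have [w'] := expr_nilp_mul zy ys1 d (m := 1) (leqW (leqnn s.+1)).
rewrite expr1 => wl wr.
have e_zd : e = u * z ^+ s.+1 * z ^+ d by rewrite -mulrA -exprD addnC.
have ezd : e * z ^+ d = z ^+ d.
  by rewrite -[RHS]zde; apply: commrX.
have ee : e * e = e by rewrite {1}e_zd -mulrA zde -e_zd.
have eye : e * y * e = e * y.
  have -> : e * y = u * w * z ^+ d by rewrite /e -mulrA wr mulrA.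
  by rewrite -mulrA zde.
have eye' : e * y * e = y * e.
  have ye : y * e = z ^+ d * w' * u by rewrite /e (commrX _ uz) mulrA wl.
  by rewrite -[LHS]mulrA ye !mulrA ezd.
exists d, e, (z ^+ (d + s) * u); split=> //.
  by rewrite /GRing.comm -eye.
by rewrite mulrA -exprS -addnS /e (commrX _ uz).
Qed.
End Algebraic.

(** * Endomorphisms of a vector space *)

Section Endomorphisms.
Variables (k : fieldType) (V : vectType k).
Hypothesis V_neq0 : (fullv : {vspace V}) != 0%VS.

Let V_proper : (0 < dim V)%N.
Proof. by rewrite -dimvf lt0n dimv_eq0. Qed.

(* In E the product [f * g] is the composite [g \o f]. *)
Let E : algType k := lfun_algType V_proper.

Lemma mul_lfunE (f g : E) : f * g = (g \o f)%VF. Proof. by []. Qed.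

(** The space of endomorphisms has finite dimension, so the powers of [f] are
    linearly dependent. *)
Lemma lfun_algebraic (f : E) : algebraic f.
Proof.
pose n := dim 'End(V).
pose X : n.+1.-tuple 'End(V) := [tuple (f ^+ i : E) | i < n.+1].
have Xdep : ~~ free X.
  rewrite /free size_tuple neq_ltn (leq_ltn_trans (dimvS (subvf _)))//.
  by rewrite dimvf.
apply: contrapT => nalg; case/negP: Xdep; apply/freeP => c c0 i.
pose p := \poly_(j < n.+1) c (inord j).
have pE (j : 'I_n.+1) : p`_j = c j by rewrite coef_poly ltn_ord inord_val.
have [p_eq0|p_neq0] := eqVneq p 0; first by rewrite -pE p_eq0 coef0.
case: nalg; exists p => //; rewrite -[RHS]c0 /horner_alg /horner_morph.
rewrite (@horner_coef_wide _ n.+1); last first.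
  exact: leq_trans (size_poly _ _) (size_poly _ _).
apply: eq_bigr => j _; rewrite coef_map /= pE.
by rewrite (nth_map ord0) ?size_enum_ord// nth_ord_enum mulr_algl.
Qed.

(** The projector along the generalized [a]-eigenspace of [f], onto the sum of
    the others.  Since products in [E] are reversed composites, it is [a - f],
    and not [f - a], that satisfies [z g - g z = g^2] there. *)
Lemma spectral_projector (f g : 'End(V)) (a : k) : [pchar k] =i pred0 ->
    ((f \o g) - (g \o f) = g \o g)%VF ->
  exists e : 'End(V), [/\ (e \o e = e)%VF, (e \o f = f \o e)%VF,
    (e \o g = g \o e)%VF &
    forall b v, f v = b *: v -> e v = (b != a)%:R *: v].
Proof.
move=> char0 fg; pose F : E := f; pose G : E := g; pose z : E := a%:A - F.
have FG : (- F) * G - G * (- F) = G ^+ 2.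
  by rewrite mulNr mulrN opprK addrC [LHS]fg.
have zG : z * G - G * z = G ^+ 2.
  rewrite -FG /z mulrBl mulrBr -scalerAl -scalerAr mul1r mulr1.
  by rewrite opprB addrC addrA subrK mulNr mulrN opprK [RHS]addrC.
have [d [e [u [ee ez eG zde eE]]]] :=
  fitting_idempotent_comm zG (lfun_algebraic z)
    (algebraic_nilpotent char0 FG (lfun_algebraic G)).
have eF : e * F = F * e.
  apply: oppr_inj; apply: (addrI (a *: e)).
  move: ez; rewrite /GRing.comm /z mulrBl mulrBr.
  by rewrite -scalerAl -scalerAr mulr1 mul1r.
exists e; split; [exact: ee | exact: esym eF | exact: esym eG |].
move=> b v fv; have zv : (z : 'End(V)) v = (a - b) *: v.
  by rewrite !lfun_simp fv scalerBl.
have [eq_ba | neq_ba] := eqVneq b a.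
  have -> : e v = (u : 'End(V)) ((z : 'End(V)) v) by rewrite eE [LHS]comp_lfunE.
  by rewrite zv eq_ba subrr /= !scale0r linear0.
have zXv n : (z ^+ n : 'End(V)) v = (a - b) ^+ n *: v.
  elim: n => [|n IHn]; first by rewrite scale1r [LHS]id_lfunE.
  have -> : (z ^+ n.+1 : 'End(V)) v = (z ^+ n : 'End(V)) ((z : 'End(V)) v).
    by rewrite exprS [LHS]comp_lfunE.
  by rewrite zv linearZ /= IHn scalerA exprS.
(* Applying [z^d e = z^d] to v multiplies [e v = v] by (a - b)^d != 0. *)
have := congr1 (fun h : 'End(V) => h v) zde.
rewrite comp_lfunE zXv linearZ /= scale1r; apply: scalerI.
by rewrite expf_neq0 // subr_eq0 eq_sym.
Qed.
End Endomorphisms.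

Lemma leigenvalueP (k : fieldType) (V : vectType k) (f : 'End(V)) (a : k) :
  reflect (exists2 v, v != 0 & f v = a *: v) (passmx.leigenvalue f a).
Proof.
have memE v : (v \in lker (f - a *: \1%VF)) = (f v == a *: v).
  by rewrite memv_ker !lfun_simp subr_eq0.
apply: (iffP idP) => [f_a | [v v_neq0 fv]].
  exists (vpick (lker (f - a *: \1%VF))); first by rewrite vpick0.
  by apply/eqP; rewrite -memE memv_pick.
apply: contraNneq v_neq0 => f_a.
by rewrite -memv0 -f_a memE fv.
Qed.

Lemma exists_leigenvalue (k : closedFieldType) (V : vectType k) (f : 'End(V)) :
  (fullv : {vspace V}) != 0%VS -> exists a, passmx.leigenvalue f a.
Proof.
move=> V_neq0; pose B := vbasis {:V}.
have B_basis : basis_of {:V} B := vbasisP _.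
have [a] : exists a, root (char_poly (passmx.mxof B B f)) a.
  by apply/closed_rootP; rewrite size_char_poly eqSS dimv_eq0.
rewrite -eigenvalue_root_char => f_a; exists a.
by rewrite /passmx.leigenvalue (passmx.leigenspaceE B_basis) passmx.vsof_eq0.
Qed.

(** * Modules over the Jordan plane *)

(** The image and the kernel of [e] are complementary submodules. *)
Lemma indecomposable_idempotent (k : fieldType) (A : algType k) (M : fdModule A)
    (e : 'End(M)) :
  indecomposable M -> (e \o e = e)%VF ->
  (forall a, (e \o fdm_act M a = fdm_act M a \o e)%VF) -> e = 0 \/ e = \1%VF.
Proof.
move=> [_ indM] ee e_act.
have eeE v : e (e v) = e v by rewrite -comp_lfunE ee.
have e_actE a v : e (fdm_act M a v) = fdm_act M a (e v).
  by rewrite -!comp_lfunE e_act.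
have im_sub : submodule (limg e).
  move=> a; apply/subvP => _ /memv_imgP[_ /memv_imgP[v _ ->] ->].
  by rewrite -e_actE memv_img ?memvf.
have ker_sub : submodule (lker e).
  move=> a; apply/subvP => _ /memv_imgP[v v_ker ->].
  by move: v_ker; rewrite !memv_ker e_actE => /eqP->; rewrite linear0.
have im_ker_full : (limg e + lker e)%VS = fullv.
  apply/vspaceP => v; rewrite memvf.
  rewrite -[v](subrK (e v)) addrC; apply: memv_add.
    by rewrite memv_img ?memvf.
  by rewrite memv_ker linearB /= eeE subrr.
have im_ker0 : (limg e :&: lker e)%VS = 0%VS.
  apply/eqP; rewrite -subv0; apply/subvP => v.
  by rewrite memv_cap => /andP[/memv_imgP[w _ ->]]; rewrite memv_ker eeE memv0.
have [im0|ker0] := indM _ _ im_sub ker_sub im_ker_full im_ker0.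
  left; apply/lfunP => v; rewrite zero_lfunE; apply/eqP.
  by rewrite -memv0 -im0 memv_img ?memvf.
right; apply/lfunP => v; rewrite id_lfunE.
have /lker0P e_inj : lker e == 0%VS by rewrite ker0.
by apply: e_inj; rewrite eeE.
Qed.

(** Every element is the image of a linear combination of words in two letters,
    and a word is a product of letters. *)
Lemma jordan_plane_ind (k : fieldType) (P : jordan_plane k -> Prop) :
    P 1 -> P jordan_x -> P jordan_y ->
    (forall a u v, P u -> P v -> P (a *: u + v)) ->
    (forall u v, P u -> P v -> P (u * v)) ->
  forall u, P u.
Proof.
move=> P1 Px Py Plin Pmul u; rewrite -[u]jordan_reprK.
have P0 : P 0 by rewrite -[0](addNr 1) -scaleN1r; apply: Plin.
rewrite [jordan_repr u]monalgE raddf_sum /=.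
elim/big_rec: _ => // m v _ Pv.
have -> : << (jordan_repr u)@_m *g m >> = (jordan_repr u)@_m *: << m >>.
  by apply/malgP => m'; rewrite mcoeffZ !mcoeffU mulrnAr mulr1.
rewrite linearZ /=; apply: Plin Pv => {v}.
case: m => s; elim: s => [|b s IHs].
  have -> : FMonom [::] = mone :> {fmonom bool} by apply/eqP; rewrite fmP fm1.
  by rewrite [X in jordan_pi X](_ : _ = 1) ?rmorph1.
have -> : FMonom (b :: s) = mmul (fmu b) (FMonom s).
  by apply/eqP; rewrite fmP fmM fmU.
have -> : << mmul (fmu b) (FMonom s) >>
    = << fmu b >> * << FMonom s >> :> free_alg2 k.
  by rewrite malgME !msuppU1 !big_seq_fset1 !mcoeffUU mulr1.
by rewrite rmorphM; apply: Pmul; last exact: IHs; case: b.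
Qed.

Theorem lemma6p1 (k : closedFieldType) (char0 : [pchar k] =i pred0)
    (M : fdModule (jordan_plane k)) (indM : indecomposable M) :
  exists! a : k, passmx.leigenvalue (fdm_act M jordan_x) a.
Proof.
have [a X_a] := exists_leigenvalue (fdm_act M jordan_x) (proj1 indM).
exists a; split=> // b /leigenvalueP[w w_neq0 Xw].
have XY : ((fdm_act M jordan_x \o fdm_act M jordan_y)
    - (fdm_act M jordan_y \o fdm_act M jordan_x)
    = fdm_act M jordan_y \o fdm_act M jordan_y)%VF.
  rewrite -!fdm_actM -expr2 -jordan_xy.
  by rewrite -scaleN1r addrC -fdm_act_linear scaleN1r addrC.
have [e [ee eX eY e_eig]] := spectral_projector (proj1 indM) a char0 XY.
have e_act u : (e \o fdm_act M u = fdm_act M u \o e)%VF.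
  elim/jordan_plane_ind: u => // [|c u v eu ev|u v eu ev].
  - by rewrite fdm_act1 comp_lfun1l comp_lfun1r.
  - rewrite fdm_act_linear comp_lfunDl comp_lfunDr.
    by rewrite -comp_lfunZl -comp_lfunZr eu ev.
  - by rewrite fdm_actM comp_lfunA eu -comp_lfunA ev comp_lfunA.
have [e0|e1] := indecomposable_idempotent indM ee e_act; last first.
  have /leigenvalueP[v v_neq0 Xv] := X_a.
  have := e_eig a v Xv; rewrite e1 id_lfunE eqxx scale0r => v0.
  by rewrite v0 eqxx in v_neq0.
have := e_eig b w Xw; rewrite e0 zero_lfunE; have [//|_] := eqVneq b a.
by rewrite scale1r => w0; rewrite -w0 eqxx in w_neq0.
Qed.
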